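(* Let $\pi,\sigma,\tau\in\mathfrak{B}_n$ be selected independently and uniformly at random, and let $p_{n,3}:=\mathbb{P}(\pi,\sigma,\tau\text{ are comparable})$ and $p_{n,3,\le}:=\mathbb{P}(\pi\le\sigma\le\tau)$, with respect to Bruhat order. Then for $n\ge 2$, $$p_{n,3}=\frac{(n^2+4n+6)\,\mathfrak{b}_{n+3}\mathfrak{b}_{n+6}-42(n+6)(n+7)\,\mathfrak{b}_{n+2}+420(n+6)(n+7)}{70(n+6)(n+7)\,\mathfrak{b}_n^2}$$ and $$p_{n,3,\le}=\frac{(n^2+4n+6)\,\mathfrak{b}_{n+3}\mathfrak{b}_{n+6}}{420(n+6)(n+7)\,\mathfrak{b}_n^2}.$$
   Context: $\mathfrak{S}_n$ is the set of permutations of $[n]=\{1,\dots,n\}$, in one-line notation. A reduction of $\omega\in\mathfrak{S}_n$ interchanges $\omega(i)$ and $\omega(j)$ for some $i<j$ with $\omega(i)>\omega(j)$. Bruhat order: $\pi\le\sigma$ if $\pi$ is obtained from $\sigma$ by a (possibly empty) sequence of reductions. $\mathfrak{B}_n\subseteq\mathfrak{S}_n$ is the set of bigrassmannian permutations, i.e. those $\omega$ such that both $\omega$ and $\omega^{-1}$ have exactly one descent (a descent of $\omega$ is an $i\in\{1,\dots,n-1\}$ with $\omega(i)>\omega(i+1)$); equivalently $\omega=1\cdots a\,(b+1)\cdots c\,(a+1)\cdots b\,(c+1)\cdots n$ for some $0\le a<b<c\le n$. For each $m\ge 1$, $\mathfrak{b}_m=|\mathfrak{B}_m|=\binom{m+1}{3}$.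 Elements $\pi_1,\dots,\pi_r\in\mathfrak{B}_n$ (not necessarily distinct) are comparable if there is a permutation $\phi$ of $\{1,\dots,r\}$ with $\pi_{\phi(1)}\le\cdots\le\pi_{\phi(r)}$.
   Formalization: The last term of the numerator of p_{n,3} is 70(n+6)(n+7) instead of the printed 420(n+6)(n+7); with 420 the formula gives 6 at n = 2, where the probability is 1. *)

(* Defs.v *)
From mathcomp Require Import all_boot all_order all_fingroup all_algebra.

Set Implicit Arguments.
Unset Strict Implicit.
Unset Printing Implicit Defensive.

Import GRing.Theory Num.Theory.
Local Open Scope ring_scope.

Section Bruhat.
Variable n : nat.

(* Permutations of [n] are elements of 'S_n, acting on {0, ..., n-1}.
   As (s * t) i = t (s i) in 'S_n, the permutation tperm i j * w is w with the
   values w i and w j, at the positions i and j, interchanged. *)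
Definition reduction : rel 'S_n := fun w v =>
  [exists i : 'I_n, exists j : 'I_n,
    [&& (i < j)%N, (w j < w i)%N & v == (tperm i j * w)%g]].

(* connect is the reflexive transitive closure. *)
Definition bruhat_le : rel 'S_n := fun u w => connect reduction w u.

Definition descents (w : 'S_n) : {set 'I_n} :=
  [set i : 'I_n | [exists j : 'I_n, (j == i.+1 :> nat) && (w j < w i)%N]].

Definition bigrassmannian : {set 'S_n} :=
  [set w | (#|descents w| == 1%N) && (#|descents w^-1%g| == 1%N)].

Definition multichain (r : nat) (t : r.-tuple 'S_n) : bool :=
  sorted bruhat_le t.

Definition comparable (r : nat) (t : r.-tuple 'S_n) : bool :=
  [exists phi : 'S_r, multichain [tuple tnth t (phi i) | i < r]].

End Bruhat.

Definition bg_card (m : nat) : nat := #|bigrassmannian m|.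

Definition uniform (R : realFieldType) (T : finType) (A : {set T}) (x : T) : R :=
  if x \in A then #|A|%:R^-1 else 0.

(* Independence of the r coordinates is the product form of the weights. *)
Definition iid_uniform_pr (R : realFieldType) (T : finType) (A : {set T})
    (r : nat) (E : pred (r.-tuple T)) : R :=
  \sum_(t : r.-tuple T | E t) \prod_(i < r) uniform R A (tnth t i).

Definition pr_comparable (R : realFieldType) (n r : nat) : R :=
  iid_uniform_pr R (bigrassmannian n) (@comparable n r).

Definition pr_multichain (R : realFieldType) (n r : nat) : R :=
  iid_uniform_pr R (bigrassmannian n) (@multichain n r).

(* Main.v *)
Require Import Defs.
From mathcomp Require Import all_boot all_order all_fingroup all_algebra.
From mathcomp Require Import zify ring.

(* A bigrassmannian permutation exchanges two adjacent blocks of lengths x and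
   y after a initial fixed points; put d = n - a - x - y.  Bruhat order becomes:
   a and d decrease, x and y increase.  Exchanging (a, d) with (x - 1, y - 1)
   is an anti-automorphism, so a principal filter is counted like a principal
   ideal, whose size depends only on (x, y).  Hence the numbers of pairs
   pi <= sigma and of triples pi <= sigma <= tau are convolutions of binomial
   coefficients.  Finally, for a poset with N3 such triples, N2 such pairs and
   N1 elements, 6 N3 - 6 N2 + N1 triples are comparable. *)

Set Implicit Arguments.
Unset Strict Implicit.
Unset Printing Implicit Defensive.

(** * Block permutations *)

Definition block_swap (a x y i : nat) : nat :=
  if i < a then i else if i < a + y then i + x
  else if i < a + x + y then i - y else i.

(** Parameters that do not fit in [n] give the identity, so that injectivity, and hence
    [block_perm], needs no side condition. *)
Definition block_fun (n a x y : nat) (i : 'I_n) : 'I_n :=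
  if a + x + y <= n then insubd i (block_swap a x y i) else i.

Ltac if_lia := repeat
  match goal with |- context [if ?b then _ else _] =>
    lazymatch b with
    | context [if _ then _ else _] => fail
    | _ => case: (boolP b) => ?
    end
  end; lia.

Lemma block_swap_lt n a x y i :
  a + x + y <= n -> i < n -> block_swap a x y i < n.
Proof. rewrite /block_swap; if_lia. Qed.

Lemma block_swapK a x y : cancel (block_swap a x y) (block_swap a y x).
Proof. move=> i; rewrite /block_swap; if_lia. Qed.

Lemma block_funE n a x y (i : 'I_n) : a + x + y <= n ->
  block_fun a x y i = block_swap a x y i :> nat.
Proof.
by move=> le_n; rewrite /block_fun le_n val_insubd block_swap_lt.
Qed.

Lemma block_fun_inj n a x y : injective (@block_fun n a x y).
Proof.
move=> i j; case: (boolP (a + x + y <= n)) => [le_n|/negPf gt_n].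
  move=> /(congr1 val) /=; rewrite !block_funE //.
  by move=> /(can_inj (@block_swapK a x y))/val_inj.
by rewrite /block_fun gt_n.
Qed.

(** When [a + x + y <= n], this is the one-line form 1..a (b+1)..c (a+1)..b (c+1)..n with b = a + x
    and c = a + x + y. *)
Definition block_perm n a x y : 'S_n := perm (@block_fun_inj n a x y).

Lemma block_permE n a x y (i : 'I_n) : a + x + y <= n ->
  block_perm n a x y i = block_swap a x y i :> nat.
Proof. by move=> le_n; rewrite permE block_funE. Qed.

Lemma block_permV n a x y : a + x + y <= n ->
  (block_perm n a x y)^-1%g = block_perm n a y x.
Proof.
move=> le_n; apply/eqP; rewrite eq_invg_mul; apply/eqP/permP => i.
apply: val_inj; rewrite permM perm1 /= !block_permE ?block_swapK //.
by rewrite addnAC.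
Qed.

Lemma descents_block_perm n a x y : a + x.+1 + y.+1 <= n ->
  #|descents (block_perm n a x.+1 y.+1)| = 1.
Proof.
(* The only descent is at the last position of the first moved block, which has length [y.+1] and
   starts at [a]. *)
move=> le_n; have lt_n : a + y < n by lia.
apply/eqP/cards1P; exists (Ordinal lt_n); apply/setP => i.
rewrite !inE; apply/existsP/eqP => [[j /andP[/eqP ji]]|->].
  rewrite !block_permE ?ji // /block_swap => lt; apply: val_inj; move: lt => /=.
  by if_lia.
have lt_n' : (a + y).+1 < n by lia.
by exists (Ordinal lt_n'); rewrite /= eqxx !block_permE //= /block_swap; if_lia.
Qed.

Lemma block_perm_bigrassmannian n a x y : a + x.+1 + y.+1 <= n ->
  block_perm n a x.+1 y.+1 \in bigrassmannian n.
Proof.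
move=> le_n; rewrite inE block_permV // !descents_block_perm //; lia.
Qed.

(** * Ranks of the upper left corners of the permutation matrix, and Bruhat order *)

Definition corner_rank n (w : 'S_n) (p q : nat) : nat :=
  \sum_(i < n) ((i < p) && (w i < q)).

(** The corner [(a + y, a + x)] has rank [a], and each further row or column adds at most one; the
    block permutation attains this bound at every corner. *)
Lemma corner_rank_block n a x y p q : a + x + y <= n -> p <= n ->
  corner_rank (block_perm n a x y) p q =
    minn (minn p q) (a + (p - (a + y)) + (q - (a + x))).
Proof.
move=> le_n le_p.
(* The sum over positions below [p] no longer involves [n], so the induction on [p] needs no
   bound. *)
have -> : corner_rank (block_perm n a x y) p q
          = \sum_(i < p) (block_swap a x y i < q : nat).
  rewrite (big_ord_widen n (fun i => (block_swap a x y i < q : nat)) le_p).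
  rewrite [RHS]big_mkcond; apply: eq_bigr => i _.
  by rewrite block_permE //; case: ifP.
elim: p {le_p} => [|p IHp]; first by rewrite big_ord0; lia.
rewrite big_ord_recr /= IHp /block_swap; if_lia.
Qed.

(** Only the terms at [i] and [j] change; adding the old ones on one side and the new ones on the
    other avoids subtraction in [nat]. *)
Lemma corner_rank_tperm n (w : 'S_n) (i j : 'I_n) p q : i != j ->
  corner_rank (tperm i j * w)%g p q + (((i < p) && (w i < q)) + ((j < p) && (w j < q)))
  = corner_rank w p q + (((i < p) && (w j < q)) + ((j < p) && (w i < q))).
Proof.
move=> ij; have ji : j != i by rewrite eq_sym.
rewrite /corner_rank (bigD1 i) // (bigD1 j) //=.
rewrite [in RHS](bigD1 i) // [in RHS](bigD1 j) //= !permM tpermL tpermR.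
have -> : \sum_(k < n | (k != i) && (k != j)) ((k < p) && ((tperm i j * w)%g k < q))
        = \sum_(k < n | (k != i) && (k != j)) ((k < p) && (w k < q)).
  apply: eq_bigr => k /andP[ki kj].
  by rewrite permM tpermD // eq_sym.
set S := (\sum_(k < n | _) _); lia.
Qed.

Lemma reduction_corner_rank n (w v : 'S_n) p q :
  reduction w v -> corner_rank w p q <= corner_rank v p q.
Proof.
case/existsP => i /existsP[j /and3P[ij wij /eqP ->]].
have := @corner_rank_tperm n w i j p q; case: eqP => [eij|_ /(_ isT)].
  by move: ij; rewrite eij ltnn.
by case: (ltnP i p); case: (ltnP j p); case: (ltnP (w i) q);
  case: (ltnP (w j) q) => /=; lia.
Qed.

Lemma bruhat_corner_rank n (u v : 'S_n) p q :
  bruhat_le u v -> corner_rank v p q <= corner_rank u p q.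
Proof.
case/connectP => s + ->; elim: s v => //= w s IHs v /andP[vw /IHs].
by apply: leq_trans; exact: reduction_corner_rank.
Qed.

Lemma sum_ord_ltn n m : m <= n -> \sum_(i < n) (i < m : nat) = m.
Proof.
move=> le_m; rewrite -[RHS]card_ord -sum1_card.
rewrite (big_ord_widen n (fun _ => 1) le_m) [RHS]big_mkcond.
by apply: eq_bigr => i _; case: ifP.
Qed.

Lemma sum_perm_ltn n (w : 'S_n) m : m <= n ->
  \sum_(i < n) (w i < m : nat) = m.
Proof.
move=> le_m; rewrite -[RHS](sum_ord_ltn le_m).
by rewrite [RHS](reindex_inj (@perm_inj _ w)).
Qed.

(* Each hypothesis confines the inversions, so the four blocks cut out by
   [p] and [q] are shifted rigidly: [w i] is [i] plus the number of inversions
   with left end [i] minus the number of those with right end [i]. *)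
Lemma block_perm_of_inversions n (w : 'S_n) p q (a := corner_rank w p q) :
  p <= n -> q <= n ->
  (forall i j : 'I_n, i < j -> w j < w i -> [/\ i < p <= j & w j < q <= w i]) ->
  [/\ a <= p, a <= q, p + q <= a + n & w = block_perm n a (q - a) (p - a)].
Proof.
move=> le_p le_q Hinv.
(* [B] and [C] mark the positions in the two off-diagonal quadrants. Their numbers [q - a] and
   [p - a] are the shifts of the two moved blocks. *)
pose B (i : 'I_n) : nat := (p <= i) && (w i < q).
pose C (i : 'I_n) : nat := (i < p) && (q <= w i).
have sumB : a + \sum_(i < n) B i = q.
  rewrite -[RHS](sum_perm_ltn w le_q) -big_split; apply: eq_bigr => i _ /=.
  by rewrite /B; lia.
have sumC : a + \sum_(i < n) C i = p.
  rewrite -[RHS](sum_ord_ltn le_p) -big_split; apply: eq_bigr => i _ /=.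
  by rewrite /C; lia.
have le_n : p + q <= a + n.
  suff : p + \sum_(i < n) B i <= n by lia.
  rewrite -[X in X + _](sum_ord_ltn le_p) -big_split.
  rewrite -[X in _ <= X](@sum_ord_ltn n n) //.
  by apply: leq_sum => i _; rewrite /B ltn_ord /=; lia.
split; [lia | lia | exact: le_n |].
apply/permP => i; apply: val_inj; rewrite /= block_permE; last by lia.
have low (j : 'I_n) : j < i -> w i < w j -> j < p <= i /\ w i < q <= w j.
  by move=> ji wij; case: (Hinv _ _ ji wij).
have hi (j : 'I_n) : i < j -> w j < w i -> i < p <= j /\ w j < q <= w i.
  by move=> ij wji; case: (Hinv _ _ ij wji).
have neqw (j : 'I_n) : (j == i :> nat) = (w j == w i :> nat).
  by rewrite !(inj_eq val_inj) (inj_eq perm_inj).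
(* Once [w i], [i] and [i.+1] are counts of indices [j], every comparison below is made summand by
   summand. *)
have wiE : (w i : nat) = \sum_(j < n) (w j < w i : nat).
  by rewrite sum_perm_ltn // ltnW.
have iE : (i : nat) = \sum_(j < n) (j < i : nat) by rewrite sum_ord_ltn // ltnW.
have Sle (F G : 'I_n -> nat) : (forall j, F j <= G j) ->
    \sum_(j < n) F j <= \sum_(j < n) G j by move=> FG; apply: leq_sum.
have iS : i.+1 = \sum_(j < n) (j < i.+1 : nat) by rewrite sum_ord_ltn.
rewrite /block_swap; case: (ltnP i p) => [ip|pi]; case: (ltnP (w i) q) => [wiq|qwi].
- have -> : w i = i :> nat.
    rewrite wiE [RHS]iE; apply: eq_bigr => j _.
    by have := low j; have := hi j; have := neqw j; lia.
  suff : i < a by if_lia.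
  rewrite iS; apply: Sle => j; have := low j; have := neqw j; lia.
- have -> : w i = i + \sum_(j < n) B j :> nat.
    rewrite wiE [X in X + _]iE -big_split; apply: eq_bigr => j _ /=.
    by rewrite /B; have := low j; have := hi j; have := neqw j; lia.
  suff : a <= i by if_lia.
  rewrite iE; apply: Sle => j; have := hi j; have := neqw j; lia.
- have -> : w i = i - \sum_(j < n) C j :> nat.
    suff -> : (i : nat) = w i + \sum_(j < n) C j by rewrite addnK.
    rewrite wiE [LHS]iE -big_split; apply: eq_bigr => j _ /=.
    by rewrite /C; have := low j; have := hi j; have := neqw j; lia.
  suff : i < p + \sum_(j < n) B j by if_lia.
  rewrite -[X in X + _](sum_ord_ltn le_p) -big_split iS.
  by apply: Sle => j /=; rewrite /B; have := low j; have := neqw j; lia.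
- have -> : w i = i :> nat.
    rewrite wiE [RHS]iE; apply: eq_bigr => j _.
    by have := low j; have := hi j; have := neqw j; lia.
  suff : p + \sum_(j < n) B j <= i by if_lia.
  rewrite -[X in X + _](sum_ord_ltn le_p) -big_split [X in _ <= X]iE.
  by apply: Sle => j /=; rewrite /B; have := hi j; have := neqw j; lia.
Qed.

(** This is the rearrangement inequality for two terms. The strictly increasing moment yields
    irreducible permutations by maximality, and antisymmetry of the order. *)
Lemma reduction_moment n (w v : 'S_n) : reduction w v ->
  \sum_(i < n) i * w i < \sum_(i < n) i * v i.
Proof.
case/existsP => i /existsP[j /and3P[ij wij /eqP ->]].
have ji : j != i by apply: contraTneq ij => ->; rewrite ltnn.
rewrite (bigD1 i) // (bigD1 j) //=.
rewrite [X in _ < X](bigD1 i) // [in X in _ < X](bigD1 j) //= !permM tpermL tpermR.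
have -> : \sum_(k < n | (k != i) && (k != j)) k * (tperm i j * w)%g k
        = \sum_(k < n | (k != i) && (k != j)) k * w k.
  apply: eq_bigr => k /andP[ki kj].
  by rewrite permM tpermD // eq_sym.
set S := (\sum_(k < n | _) _); rewrite !addnA ltn_add2r.
rewrite -(subnKC ij) -(subnKC wij); nia.
Qed.

(* Below [v] take, among the permutations with [corner_rank _ p q <= a], one
   admitting no further reduction: it has no inversion inside a block of
   positions cut at [p] or of values cut at [q], so it is a block permutation,
   and its rank is exactly [a] since a reduction across the corner raises the
   rank by at most one. *)
Lemma block_perm_bruhat_le n a x y (v : 'S_n) : a + x.+1 + y.+1 <= n ->
  corner_rank v (a + y.+1) (a + x.+1) <= a ->
  bruhat_le (block_perm n a x.+1 y.+1) v.
Proof.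
move=> le_n; set p := a + y.+1; set q := a + x.+1 => rank_v.
pose P (w : 'S_n) := bruhat_le w v && (corner_rank w p q <= a).
have Pv : P v by rewrite /P rank_v /bruhat_le connect0.
case: (@arg_maxnP _ v P (fun w : 'S_n => \sum_(i < n) i * w i) Pv).
move=> w /andP[wv rank_w] max_w.
have maxP u : reduction w u -> a < corner_rank u p q.
  move=> wu; rewrite ltnNge; apply/negP => rank_u.
  have /max_w : P u.
    by rewrite /P rank_u andbT /bruhat_le (connect_trans wv) ?connect1.
  by rewrite /= leqNgt reduction_moment.
have Hred (i j : 'I_n) : i < j -> w j < w i -> a < corner_rank (tperm i j * w)%g p q.
  move=> ij wji; apply: maxP; apply/existsP; exists i; apply/existsP; exists j.
  by rewrite ij wji eqxx.
have [|||le_p le_q le_n' def_w] := @block_perm_of_inversions n w p q.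
- lia.
- lia.
- move=> i j ij wji; have := Hred _ _ ij wji.
  have := @corner_rank_tperm n w i j p q; case: eqP => [eij|_ /(_ isT)].
    by move: ij; rewrite eij ltnn.
  case: (ltnP i p); case: (ltnP j p); case: (ltnP (w i) q);
  case: (ltnP (w j) q) => /=; lia.
suff rank_eq : corner_rank w p q = a.
  by move: def_w wv; rewrite rank_eq /p /q !addKn => <-.
apply/eqP; rewrite eqn_leq rank_w leqNgt; apply/negP => lt_a.
(* Were the rank r below [a], the positions [p.-1] and [p], last of one moved block and first of the
   other, would form an inversion whose reduction has rank at most r + 1, hence at most [a]. *)
have lt_i : p.-1 < n by lia.
have lt_j : p < n by lia.
have wE (k : 'I_n) : w k =
    block_swap (corner_rank w p q) (q - corner_rank w p q)
               (p - corner_rank w p q) k :> nat.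
  by rewrite {1}def_w block_permE //; lia.
have wi := wE (Ordinal lt_i); have wj := wE (Ordinal lt_j).
have lt_w : w (Ordinal lt_j) < w (Ordinal lt_i).
  by rewrite wi wj /block_swap /=; if_lia.
have lt_ij : Ordinal lt_i < Ordinal lt_j by rewrite /=; lia.
have := Hred _ _ lt_ij lt_w.
have := @corner_rank_tperm n w (Ordinal lt_i) (Ordinal lt_j) p q.
rewrite -(inj_eq val_inj) (ltn_eqF lt_ij) => /(_ isT).
have := leq_b1 (w (Ordinal lt_j) < q); have := leq_b1 (w (Ordinal lt_i) < q).
rewrite /= ltnn; case: (p.-1 < p); lia.
Qed.

(** One corner decides: at [(a + y.+1, a + x.+1)] the larger permutation must have rank at most [a].
    By the rank formula this reads a' + max(0, a + y - a' - y') + max(0, a + x - a' - x') <= a, and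
    choosing either argument in each maximum gives the four inequalities. *)
Lemma bruhat_le_block_perm n a x y a' x' y' :
  a + x.+1 + y.+1 <= n -> a' + x'.+1 + y'.+1 <= n ->
  bruhat_le (block_perm n a x.+1 y.+1) (block_perm n a' x'.+1 y'.+1) =
  [&& a' <= a, x <= x', y <= y' & a + x + y <= a' + x' + y'].
Proof.
move=> le_n le_n'; apply/idP/idP => [le_uv|le_uv].
  have := bruhat_corner_rank (a + y.+1) (a + x.+1) le_uv.
  rewrite !corner_rank_block; lia.
apply: block_perm_bruhat_le => //; rewrite corner_rank_block; lia.
Qed.

(** * Order axioms, and the block form of bigrassmannian permutations *)

Lemma bruhat_refl n : reflexive (@bruhat_le n).
Proof. by move=> u; apply: connect0. Qed.

Lemma bruhat_trans n : transitive (@bruhat_le n).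
Proof. by move=> v u w uv vw; apply: connect_trans vw uv. Qed.

Lemma bruhat_anti n : antisymmetric (@bruhat_le n).
Proof.
have mono (u v : 'S_n) : bruhat_le u v ->
    u = v \/ \sum_(i < n) i * v i < \sum_(i < n) i * u i.
  case/connectP => s + ->; elim: s v => [|w s IHs] v /=; first by left.
  case/andP => /reduction_moment vw /IHs[->|lt_wu]; right; first exact: vw.
  exact: ltn_trans vw lt_wu.
move=> u v /andP[/mono[//|lt_uv] /mono[//|]].
by rewrite ltnNge ltnW.
Qed.

(** Either the value just before [j] is already below [w i], and induction applies, or the step into
    [j] is a descent. *)
Lemma descent_between n (w : 'S_n) (i j : 'I_n) : i < j -> w j < w i ->
  exists2 d, d \in descents w & i <= d < j.
Proof.
move=> + wji; move: {-1}(j : nat) (erefl (j : nat)) wji => m.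
elim: m j => // m IHm j jm wji; rewrite ltnS leq_eqVlt => /orP[/eqP im|im].
  exists i; last by rewrite leqnn im ltnSn.
  by rewrite inE; apply/existsP; exists j; rewrite jm im eqxx.
have lt_m : m < n by rewrite ltnW // -jm.
case: (ltnP (w (Ordinal lt_m)) (w i)) => [wmi|wim].
  by have [d d_w d_i] := IHm (Ordinal lt_m) erefl wmi im; exists d => //; lia.
exists (Ordinal lt_m); last by rewrite /=; lia.
rewrite inE; apply/existsP; exists j; rewrite jm eqxx.
exact: leq_trans wji wim.
Qed.

(** Every inversion straddles the only descent of [w] in position and the only descent of [w^-1] in
    value, as [block_perm_of_inversions] requires. *)
Lemma bigrassmannian_block_perm n (w : 'S_n) : w \in bigrassmannian n ->
  exists a x y, a + x.+1 + y.+1 <= n /\ w = block_perm n a x.+1 y.+1.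
Proof.
rewrite inE => /andP[/cards1P[i Di] /cards1P[k Dk]].
have [|||] := @block_perm_of_inversions n w i.+1 k.+1 => //.
  move=> i1 i2 lt_i lt_w; split.
    by have [d] := descent_between lt_i lt_w; rewrite Di => /set1P ->.
  have [|d] := @descent_between n w^-1%g (w i2) (w i1) lt_w.
    by rewrite !permK.
  by rewrite Dk => /set1P ->.
set a := corner_rank _ _ _ => le_i le_k le_n.
have : i \in descents w by rewrite Di set11.
rewrite inE => /existsP[j /andP[/eqP ji]] /[swap] def_w.
rewrite {1 2}def_w !block_permE ?ji; try lia.
(* An empty block would make [w] the identity, contradicting the descent at [i]. *)
case def_x: (k.+1 - a) => [|x]; first by rewrite /block_swap; if_lia.
case def_y: (i.+1 - a) => [|y]; first by rewrite /block_swap; if_lia.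
by exists a, x, y; split; [lia | rewrite def_w def_x def_y].
Qed.

(** * Convolutions of binomial coefficients *)

(** Both sides count the subsets of size [(k + l).+1] of [n.+1] points, on the left by the element
    [s] that has [k] chosen points below it and [l] above. *)
Lemma sum_bin_mul k l n :
  \sum_(s < n.+1) 'C(s, k) * 'C(n - s, l) = 'C(n.+1, (k + l).+1).
Proof.
elim: n l => [|n IHn] l.
  by rewrite big_ord1; case: k; case: l => //= *; rewrite ?bin0n ?binS ?bin0n.
rewrite big_ord_recr /= subnn.
have subS (s : 'I_n.+1) : n.+1 - s = (n - s).+1 by rewrite subSn // -ltnS.
case: l => [|l].
  rewrite bin0 muln1 binS addn0; congr (_ + _).
  rewrite -[X in 'C(_, X.+1)]addn0 -IHn.
  by apply: eq_bigr => s _; rewrite !bin0.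
rewrite bin0n muln0 addn0 binS -IHn addnS -IHn -big_split.
by apply: eq_bigr => s _; rewrite subS binS mulnDr.
Qed.

(** The first [i] and last [j] terms of the full convolution vanish because [i <= k] and
    [j <= l]. *)
Lemma sum_bin_mul_shift i j k l n : i <= k -> j <= l ->
  \sum_(s < n.+1) 'C(s + i, k) * 'C(n - s + j, l)
  = 'C((n + i + j).+1, (k + l).+1).
Proof.
move=> le_i le_j; rewrite -sum_bin_mul.
have -> : (n + i + j).+1 = i + (n.+1 + j) by lia.
rewrite big_split_ord big_split_ord /=; apply/esym; rewrite big1 => [|s _]; last first.
 by rewrite [X in X * _]bin_small // (leq_trans (ltn_ord s)).
rewrite [X in 0 + (_ + X)]big1 => [|s _]; last first.
  by rewrite [X in _ * X]bin_small ?muln0 //; have := ltn_ord s; lia.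
rewrite add0n addn0; apply: eq_bigr => s _.
by congr ('C(_, _) * 'C(_, _)); have := ltn_ord s; lia.
Qed.

Lemma sum_antidiagonal m (F : nat -> nat -> nat) :
  \sum_(x < m.+1) \sum_(y < (m - x).+1) F x y
  = \sum_(s < m.+1) \sum_(x < s.+1) F x (s - x).
Proof.
elim: m => [|m IHm]; first by rewrite !big_ord1.
rewrite big_ord_recr [RHS]big_ord_recr /= -IHm.
rewrite [X in _ = _ + X]big_ord_recr /= subnn big_ord1.
rewrite addnA; congr (_ + _); rewrite -big_split; apply: eq_bigr => x _ /=.
by rewrite subSn -1?ltnS // big_ord_recr.
Qed.

(** This is (x + 1)(y + 1)(x + y + 2)/2, written in products that [sum_bin_mul_shift] can sum. *)
Definition ideal_size (x y : nat) : nat :=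
  'C(x + 1, 2) * 'C(y + 1, 1) + 'C(x + 1, 1) * 'C(y + 1, 2)
  + 'C(x + 1, 1) * 'C(y + 1, 1).

Lemma sum_ideal_size x y :
  \sum_(i < x.+1) \sum_(j < y.+1) (x - i + (y - j) + 1) = ideal_size x y.
Proof.
have sumid n : \sum_(i < n) i = 'C(n, 2) by rewrite -bin2_sum big_mkord.
have sumrev n : \sum_(i < n.+1) (n - i) = 'C(n.+1, 2).
  rewrite -sumid [RHS](reindex_inj rev_ord_inj) /=.
  by apply: eq_bigr => i _; rewrite subSS.
have inner i : \sum_(j < y.+1) (x - i + (y - j) + 1)
    = (x - i) * y.+1 + ('C(y.+1, 2) + y.+1).
  rewrite !big_split /= sumrev !sum_nat_const !card_ord; lia.
under eq_bigr do rewrite inner.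
rewrite big_split /= -big_distrl /= sumrev sum_nat_const card_ord.
by rewrite /ideal_size !addn1 !bin1; ring.
Qed.

(** * Parameter triples, principal ideals and principal filters *)

Section BlockData.
Variable m : nat.
Notation param := ('I_m.+1 * 'I_m.+1 * 'I_m.+1)%type.
Implicit Types t u : param.

Definition admissible t := t.1.1 + t.1.2 + t.2 <= m.

Definition param_le t u :=
  [&& u.1.1 <= t.1.1, t.1.2 <= u.1.2, t.2 <= u.2
    & t.1.1 + t.1.2 + t.2 <= u.1.1 + u.1.2 + u.2].

(** A triple is [(a, x, y)]; the moved blocks have lengths [x.+1] and [y.+1], so [admissible] says
    that they fit in [m.+2] points. *)
Definition param_perm t : 'S_m.+2 := block_perm m.+2 t.1.1 t.1.2.+1 t.2.+1.

Lemma param_perm_le t u : admissible t -> admissible u ->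
  bruhat_le (param_perm t) (param_perm u) = param_le t u.
Proof.
rewrite /admissible => t_ok u_ok; rewrite bruhat_le_block_perm //; lia.
Qed.

Lemma param_perm_inj : {in admissible &, injective param_perm}.
Proof.
move=> t u t_ok u_ok eq_tu; have := bruhat_refl (param_perm t).
have := bruhat_refl (param_perm u).
rewrite -{1}eq_tu {2}eq_tu !param_perm_le //.
case: t u {t_ok u_ok eq_tu} => [[a x] y] [[a' x'] y'].
rewrite /param_le /= => le_tu le_ut.
by congr (_, _, _); apply: val_inj => /=; lia.
Qed.

Lemma bigrassmannian_param :
  bigrassmannian m.+2 = param_perm @: [set t | admissible t].
Proof.
apply/setP => w; apply/idP/imsetP => [/bigrassmannian_block_perm|].
  move=> [a [x [y [le_m ->]]]]; exists (inord a, inord x, inord y).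
    by rewrite inE /admissible /= !inordK //; lia.
  by rewrite /param_perm /= !inordK //; lia.
move=> [t]; rewrite inE /admissible => t_ok ->.
by apply: block_perm_bigrassmannian; lia.
Qed.

Lemma sum_bigrassmannian (F : 'S_m.+2 -> nat) :
  \sum_(w in bigrassmannian m.+2) F w
  = \sum_(t : param | admissible t) F (param_perm t).
Proof.
rewrite bigrassmannian_param big_imset /=.
  by apply: eq_bigl => t; rewrite inE.
by move=> t u; rewrite !inE; apply: param_perm_inj.
Qed.

Lemma sum_triple (F : nat -> nat -> nat -> nat) :
  \sum_(t : param) F t.1.1 t.1.2 t.2
  = \sum_(x < m.+1) \sum_(y < m.+1) \sum_(a < m.+1) F a x y.
Proof.
under [RHS]eq_bigr do rewrite exchange_big /=.
rewrite exchange_big /=.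
rewrite (pair_bigA _ (fun a x : 'I_m.+1 => \sum_(y < m.+1) F a x y)) /=.
by rewrite (pair_bigA _ (fun (p : 'I_m.+1 * 'I_m.+1) (y : 'I_m.+1) => F p.1 p.2 y)).
Qed.

(** For fixed [x <= x0] and [y <= y0], the coordinate [a] runs from [a0] to
    [a0 + (x0 - x) + (y0 - y)], and all these triples are admissible because [u] is. *)
Lemma card_principal_ideal u : admissible u ->
  \sum_(t : param | admissible t) (param_le t u : nat) = ideal_size u.1.2 u.2.
Proof.
case: u => [[a0 x0] y0]; rewrite /admissible /param_le /= => u_ok.
rewrite -sum_ideal_size big_mkcond.
pose F (a x y : nat) : nat :=
  [&& a0 <= a, x <= x0, y <= y0 & a + x + y <= a0 + x0 + y0].
transitivity (\sum_(t : param) F t.1.1 t.1.2 t.2).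
  by apply: eq_bigr => t _; rewrite /F; case: ifP; lia.
rewrite sum_triple.
have sumF (x y : nat) : x <= x0 -> y <= y0 ->
    \sum_(a < m.+1) F a x y = x0 - x + (y0 - y) + 1.
  move=> le_x le_y; apply/eqP; rewrite -(eqn_add2l a0); apply/eqP.
  have lt_a0 : a0 <= m.+1 by lia.
  rewrite -[X in X + _](sum_ord_ltn lt_a0) -big_split /=.
  have le_K : a0 + (x0 - x + (y0 - y) + 1) <= m.+1 by lia.
  rewrite -[RHS](sum_ord_ltn le_K).
  by apply: eq_bigr => a _; rewrite /F; lia.
have le_x : x0.+1 <= m.+1 by lia.
rewrite (big_ord_widen _ (fun x => \sum_(y < y0.+1) (x0 - x + (y0 - y) + 1)) le_x).
rewrite [RHS]big_mkcond; apply: eq_bigr => x _; rewrite ltnS.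
have le_y : y0.+1 <= m.+1 by lia.
case: (leqP x x0) => [le_xx|gt_x]; last first.
  by apply: big1 => y _; apply: big1 => a _; rewrite /F; lia.
rewrite (big_ord_widen _ (fun y => x0 - x + (y0 - y) + 1) le_y).
rewrite [RHS]big_mkcond; apply: eq_bigr => y _; rewrite ltnS.
case: (leqP y y0) => [le_yy|gt_y]; first exact: sumF.
by apply: big1 => a _; rewrite /F; lia.
Qed.

(* With [d = m - a - x - y] this exchanges the pair [(a, d)], in which the
   order is reversed, with the pair [(x, y)]. *)
Definition dual_param t : param :=
  (t.1.2, t.1.1, inord (m - (t.1.1 + t.1.2 + t.2))).

Lemma admissible_dual t : admissible t -> admissible (dual_param t).
Proof. rewrite /admissible /= => t_ok; rewrite inordK; lia. Qed.

Lemma dual_paramK t : admissible t -> dual_param (dual_param t) = t.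
Proof.
case: t => [[a x] y]; rewrite /admissible /dual_param /= => t_ok.
by congr (_, _, _); apply: val_inj; rewrite /= inordK inordK; lia.
Qed.

Lemma param_le_dual t u : admissible t -> admissible u ->
  param_le (dual_param t) (dual_param u) = param_le u t.
Proof.
rewrite /admissible /param_le /= => t_ok u_ok; rewrite !inordK; lia.
Qed.

Lemma card_principal_filter u : admissible u ->
  \sum_(t : param | admissible t) (param_le u t : nat)
  = ideal_size u.1.1 (m - (u.1.1 + u.1.2 + u.2)).
Proof.
move=> u_ok; have := card_principal_ideal (admissible_dual u_ok).
rewrite /= inordK; last by lia.
move=> <-; rewrite (reindex_onto dual_param dual_param); last exact: dual_paramK.
apply: eq_big => t; last first.
  by move=> /andP[t_ok /eqP tK]; rewrite -[in RHS]tK param_le_dual.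
apply/andP/idP => [[t_ok /eqP <-]|t_ok]; first exact: admissible_dual.
by rewrite admissible_dual // dual_paramK.
Qed.

(** Once s = x + y is fixed, a + d = m - s is fixed too, and the choices of (x, y) and of (a, d) are
    independent. *)
Lemma sum_param (G H : nat -> nat -> nat) :
  \sum_(t : param | admissible t)
     G t.1.2 t.2 * H t.1.1 (m - (t.1.1 + t.1.2 + t.2))
  = \sum_(s < m.+1) (\sum_(x < s.+1) G x (s - x))
                    * (\sum_(a < (m - s).+1) H a (m - s - a)).
Proof.
pose K (s : nat) := \sum_(a < (m - s).+1) H a (m - s - a).
under [RHS]eq_bigr => s _ do rewrite big_distrl.
have -> : \sum_(s < m.+1) \sum_(x < s.+1) G x (s - x) * K s
   = \sum_(s < m.+1) \sum_(x < s.+1) (fun x y => G x y * K (x + y)) x (s - x).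
  apply: eq_bigr => s _; apply: eq_bigr => x _; rewrite subnKC //.
  by rewrite -ltnS.
rewrite -(sum_antidiagonal m (fun x y => G x y * K (x + y))) big_mkcond.
pose F (a x y : nat) : nat :=
  if a + x + y <= m then G x y * H a (m - (a + x + y)) else 0.
transitivity (\sum_(t : param) F t.1.1 t.1.2 t.2) => //.
rewrite sum_triple.
apply: eq_bigr => x _.
have le_y : (m - x).+1 <= m.+1 by lia.
rewrite (big_ord_widen _ (fun y => G x y * K (x + y)) le_y).
rewrite [RHS]big_mkcond; apply: eq_bigr => y _.
case: (ltnP y (m - x).+1) => [lt_y|gt_y]; last first.
  by apply: big1 => a _; rewrite /F ifF //; have := ltn_ord x; lia.
have le_a : (m - (x + y)).+1 <= m.+1 by lia.
rewrite /K (big_ord_widen _ (fun a => H a (m - (x + y) - a)) le_a).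
rewrite big_distrr [RHS]big_mkcond; apply: eq_bigr => a _.
rewrite /F ltnS; have := ltn_ord x; case: ifP => le1 lt_x; case: ifP => le2 //; try lia.
by congr (_ * H _ _); lia.
Qed.

End BlockData.

(** * Numbers of elements, pairs and chains of three *)

Lemma sum_one_antidiagonal t : \sum_(a < t.+1) 1 = 'C(t + 1, 1).
Proof. by rewrite sum1_card card_ord bin1 addn1. Qed.

Lemma ideal_size_antidiagonal t :
  \sum_(x < t.+1) ideal_size x (t - x) = 'C(t + 4, 4) + 'C(t + 3, 4).
Proof.
rewrite /ideal_size !big_split /= !sum_bin_mul_shift //.
(* The three sums are 'C(t + 3, 4) twice and 'C(t + 3, 3); Pascal's rule merges the last with one of
   the others. *)
have -> : (t + 1 + 1).+1 = t + 3 by lia.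
by rewrite (addnS t 3) binS addnAC.
Qed.

Section ChainCounts.
Variable m : nat.
Notation B := (bigrassmannian m.+2).

Lemma card_bigrassmannian : bg_card m.+2 = 'C(m + 3, 3).
Proof.
rewrite /bg_card -sum1_card sum_bigrassmannian.
have := @sum_param m (fun _ _ => 1) (fun _ _ => 1); rewrite /= => ->.
under eq_bigr do rewrite !sum_one_antidiagonal.
by rewrite sum_bin_mul_shift //; congr ('C(_, _)); lia.
Qed.

Lemma count_multichain2 :
  \sum_(u in B) \sum_(v in B) (bruhat_le u v : nat)
  = 'C(m + 6, 6) + 'C(m + 5, 6).
Proof.
rewrite exchange_big sum_bigrassmannian.
transitivity (\sum_(t : 'I_m.+1 * 'I_m.+1 * 'I_m.+1 | admissible t)
                ideal_size t.1.2 t.2 * 1).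
  apply: eq_bigr => t t_ok; rewrite muln1 -card_principal_ideal // sum_bigrassmannian.
  by apply: eq_bigr => u u_ok; rewrite param_perm_le.
have := @sum_param m ideal_size (fun _ _ => 1); rewrite /= => ->.
under eq_bigr do rewrite sum_one_antidiagonal ideal_size_antidiagonal mulnDl.
by rewrite big_split /= !sum_bin_mul_shift //; congr ('C(_, _) + 'C(_, _)); lia.
Qed.

(** Summing over the middle element, the choices below and above it are independent: a principal
    ideal, sized by (x, y), and a principal filter, sized by (a, d). *)
Lemma count_multichain3 :
  \sum_(u in B) \sum_(v in B) \sum_(w in B) (bruhat_le u v && bruhat_le v w : nat)
  = 'C(m + 9, 9) + 2 * 'C(m + 8, 9) + 'C(m + 7, 9).
Proof.
rewrite exchange_big sum_bigrassmannian.
transitivity (\sum_(t : 'I_m.+1 * 'I_m.+1 * 'I_m.+1 | admissible t)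
   ideal_size t.1.2 t.2 * ideal_size t.1.1 (m - (t.1.1 + t.1.2 + t.2))).
  apply: eq_bigr => t t_ok; rewrite -card_principal_ideal // -card_principal_filter //.
  rewrite sum_bigrassmannian big_distrl; apply: eq_bigr => u u_ok.
  rewrite sum_bigrassmannian big_distrr; apply: eq_bigr => w w_ok.
  by rewrite !param_perm_le //= mulnb.
rewrite sum_param.
under eq_bigr do rewrite !ideal_size_antidiagonal mulnDl !mulnDr.
rewrite !big_split /= !sum_bin_mul_shift // -[(4 + 4).+1]/9.
have -> : (m + 4 + 4).+1 = m + 9 by lia.
have -> : (m + 4 + 3).+1 = m + 8 by lia.
have -> : (m + 3 + 4).+1 = m + 8 by lia.
have -> : (m + 3 + 3).+1 = m + 7 by lia.
lia.
Qed.

End ChainCounts.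

(** * Probabilities as normalised counts *)

Section Probability.
Import GRing.Theory Num.Theory.
Local Open Scope ring_scope.

Lemma sum_tuple3 (V : nmodType) (T : finType) (F : 3.-tuple T -> V) :
  \sum_(t : 3.-tuple T) F t
  = \sum_(x : T) \sum_(y : T) \sum_(z : T) F [tuple x; y; z].
Proof.
pose h (p : T * T * T) : 3.-tuple T := [tuple p.1.1; p.1.2; p.2].
rewrite (reindex h) /=; last first.
  exists (fun t : 3.-tuple T => (tnth t 0, tnth t 1, tnth t 2%:R)).
    by move=> [[x y] z] _.
  move=> t _; apply: eq_from_tnth => i; case: i => -[|[|[|//]]] lt_i;
    by rewrite [LHS](tnth_nth (tnth t 0)) /=; congr (tnth _ _); apply: val_inj.
rewrite -(pair_bigA _ (fun (p : T * T) z => F [tuple p.1; p.2; z])) /=.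
by rewrite -(pair_bigA _ (fun x y => \sum_(z : T) F [tuple x; y; z])).
Qed.

Lemma iid_uniform_pr3 (R : realFieldType) (T : finType) (A : {set T})
    (E : pred (3.-tuple T)) :
  iid_uniform_pr R A E =
  (\sum_(x in A) \sum_(y in A) \sum_(z in A) (E [tuple x; y; z] : nat))%:R
    / #|A|%:R ^+ 3.
Proof.
have sumA (G : T -> R) : \sum_x uniform R A x * G x
    = #|A|%:R^-1 * \sum_(x in A) G x.
  rewrite big_distrr [RHS]big_mkcond; apply: eq_bigr => x _ /=.
  by rewrite /uniform; case: ifP; rewrite ?mul0r.
pose e x y z : R := (E [tuple x; y; z] : nat)%:R.
have weight x y z : (if E [tuple x; y; z]
      then \prod_(i < 3) uniform R A (tnth [tuple x; y; z] i) else 0)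
    = uniform R A x * (uniform R A y * (uniform R A z * e x y z)).
  rewrite !big_ord_recl big_ord0 mulr1 !(tnth_nth x) /= /e.
  by case: (E _); rewrite ?mulr1 ?mulr0.
have -> : iid_uniform_pr R A E = \sum_x uniform R A x *
    \sum_y uniform R A y * \sum_z uniform R A z * e x y z.
  rewrite /iid_uniform_pr big_mkcond sum_tuple3; apply: eq_bigr => x _.
  rewrite big_distrr; apply: eq_bigr => y _ /=; rewrite !big_distrr.
  by apply: eq_bigr => z _; rewrite weight.
rewrite sumA /=; under eq_bigr => x _ do rewrite sumA /=.
have sumAA x : \sum_(y in A) \sum_z uniform R A z * e x y z
    = #|A|%:R^-1 * \sum_(y in A) \sum_(z in A) e x y z.
  by rewrite big_distrr; apply: eq_bigr => y _; rewrite sumA.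
under eq_bigr => x _ do rewrite sumAA.
rewrite -!big_distrr /= natr_sum.
under [in RHS]eq_bigr => x _ do
  (rewrite natr_sum; under eq_bigr => y _ do rewrite natr_sum).
by rewrite [RHS]mulrC exprS expr2 !invfM !mulrA.
Qed.
End Probability.

(** * Comparable triples *)

Lemma multichain3 n (x y z : 'S_n) :
  multichain [tuple x; y; z] = bruhat_le x y && bruhat_le y z.
Proof. by rewrite /multichain /= andbT. Qed.

(** Conversely to sorting, each of the eight orientations of the three pairs, even a cyclic one,
    contains two consecutive relations and hence a chain. *)
Lemma comparable3 n (x y z : 'S_n) (le := @bruhat_le n) :
  Defs.comparable [tuple x; y; z] =
  [&& le x y || le y x, le y z || le z y & le x z || le z x].
Proof.
set t := [tuple x; y; z].
have compP : reflect (exists2 s, perm_eq s t & sorted le s) (Defs.comparable t).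
  apply: (iffP existsP) => [[phi s_phi]|[s /tuple_permP[phi def_s] s_s]].
    exists [tuple tnth t (phi i) | i < 3] => //.
    by apply/tuple_permP; exists phi.
  by exists phi; rewrite /multichain -def_s.
apply/compP/idP => [[s st s_s]|].
  have tot : {in t &, total le}.
    move=> u v; rewrite -!(perm_mem st) {st}.
    case: (sorted_pairwise (@bruhat_trans n) s) s_s => -> pw.
    elim: s pw => //= w s IHs /andP[/allP le_w /IHs{}IHs].
    rewrite !inE => /predU1P[->|us] /predU1P[->|vs].
    - by rewrite /le bruhat_refl.
    - by rewrite /le le_w.
    - by rewrite /le le_w ?orbT.
    - exact: IHs.
  by rewrite !tot // !inE eqxx ?orbT.
have perm3 (a b c : 'S_n) :
    (forall P : pred 'S_n, P a + (P b + P c) = P x + (P y + P z)) ->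
    le a b -> le b c -> exists2 s, perm_eq s t & sorted le s.
  move=> eqP ab bc; exists [:: a; b; c]; last by rewrite /= ab bc.
  by apply/seq.permP => P /=; have := eqP P; lia.
case/and3P => /orP[xy|yx] /orP[yz|zy] /orP[xz|zx].
- by apply: (perm3 x y z) => // P; lia.
- by apply: (perm3 x y z) => // P; lia.
- by apply: (perm3 x z y) => // P; lia.
- by apply: (perm3 z x y) => // P; lia.
- by apply: (perm3 y x z) => // P; lia.
- by apply: (perm3 y z x) => // P; lia.
- by apply: (perm3 z y x) => // P; lia.
- by apply: (perm3 z y x) => // P; lia.
Qed.

(** A comparable triple satisfies one of the six chain conditions if its entries are distinct, two
    if exactly two coincide, and six if all do. The six equality terms on the left are then worth 0,
    1 and 6, and the last term on the right 0, 0 and 1. *)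
Lemma comparable3_count n (x y z : 'S_n) (le := @bruhat_le n) :
  Defs.comparable [tuple x; y; z]
  + ((x == y) && le x z + ((x == y) && le z x) + ((y == z) && le y x)
     + ((y == z) && le x y) + ((x == z) && le x y) + ((x == z) && le y x))
  = (le x y && le y z) + (le x z && le z y) + (le y x && le x z)
    + (le y z && le z x) + (le z x && le x y) + (le z y && le y x)
    + ((x == y) && (y == z)).
Proof.
rewrite comparable3 -/le.
have tr u v w : le u v -> le v w -> le u w by move=> uv; apply: bruhat_trans.
have an u v : le u v -> le v u -> (u == v).
  by move=> uv vu; apply/eqP/bruhat_anti/andP.
have eqs u v : (u == v) -> le u v by move=> /eqP ->; apply: bruhat_refl.
have es (u v : 'S_n) : (u == v) = (v == u) by exact: eq_sym.
have := tr x y z; have := tr x z y; have := tr y x z; have := tr y z x.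
have := tr z x y; have := tr z y x.
have := an x y; have := an y z; have := an x z.
have := eqs x y; have := eqs y z; have := eqs x z.
have := eqs y x; have := eqs z y; have := eqs z x.
rewrite (es y x) (es z y) (es z x).
case: (le x y); case: (le y x); case: (le x z); case: (le z x);
case: (le y z); case: (le z y);
case: (x == y); case: (y == z); case: (x == z) => //=; intuition.
Qed.

Lemma sum_pred1_and (T : finType) (A : {set T}) (x : T) (b : T -> bool) : x \in A ->
  \sum_(y in A) ((x == y) && b y : nat) = b x.
Proof.
move=> xA; rewrite (bigD1 x) //= eqxx big1 ?addn0 // => y /andP[_ /negPf yx].
by rewrite eq_sym yx.
Qed.

Lemma count_comparable3 n (A := bigrassmannian n) (le := @bruhat_le n) :
  \sum_(x in A) \sum_(y in A) \sum_(z in A) (Defs.comparable [tuple x; y; z] : nat)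
  + 6 * \sum_(x in A) \sum_(y in A) (le x y : nat)
  = 6 * \sum_(x in A) \sum_(y in A) \sum_(z in A) (le x y && le y z : nat) + #|A|.
Proof.
pose S (F : 'S_n -> 'S_n -> 'S_n -> nat) :=
  \sum_(x in A) \sum_(y in A) \sum_(z in A) F x y z.
have SD F G : S (fun x y z => F x y z + G x y z) = S F + S G.
  rewrite /S -big_split; apply: eq_bigr => x _.
  by rewrite -big_split; apply: eq_bigr => y _; rewrite -big_split.
(* These two transpositions generate all renamings of the variables, so the six chain terms have the
   same sum. *)
have S23 F : S (fun x y z => F x z y) = S F.
  by apply: eq_bigr => x _; rewrite exchange_big.
have S12 F : S (fun x y z => F y x z) = S F by rewrite /S exchange_big.
pose C x y z : nat := le x y && le y z.
pose E x y z : nat := (x == y) && le x z.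
pose E' x y z : nat := (x == y) && le z x.
set M := \sum_(x in A) \sum_(y in A) (le x y : nat).
have SE : S E = M.
  apply: eq_bigr => x xA; rewrite exchange_big; apply: eq_bigr => z _.
  exact: (sum_pred1_and (fun=> le x z)).
have SE' : S E' = M.
  rewrite /M exchange_big; apply: eq_bigr => x xA.
  rewrite exchange_big; apply: eq_bigr => z _.
  exact: (sum_pred1_and (fun=> le z x)).
have Seq : S (fun x y z => (x == y) && (y == z)) = #|A|.
  rewrite -sum1_card; apply: eq_bigr => x xA.
  rewrite exchange_big /= -[RHS]/(true : nat).
  rewrite -(sum_pred1_and (fun=> true) xA); apply: eq_bigr => z zA.
  by rewrite (sum_pred1_and (fun y => y == z)) // andbT.
pose SC := S C.
have C132 : S (fun x y z => C x z y) = SC by rewrite S23.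
have C213 : S (fun x y z => C y x z) = SC by rewrite S12.
have C231 : S (fun x y z => C y z x) = SC.
  by rewrite -C132 -[RHS]S12.
have C312 : S (fun x y z => C z x y) = SC.
  by rewrite -C213 -[RHS]S23.
have C321 : S (fun x y z => C z y x) = SC.
  by rewrite -C312 -[RHS]S12.
have E1 : S (fun x y z => E y z x) = M by rewrite -SE -[RHS]S23 -[RHS]S12.
have E1' : S (fun x y z => E' y z x) = M by rewrite -SE' -[RHS]S23 -[RHS]S12.
have E2 : S (fun x y z => E x z y) = M by rewrite S23.
have E2' : S (fun x y z => E' x z y) = M by rewrite S23.
have : S (fun x y z => Defs.comparable [tuple x; y; z]
    + (E x y z + E' x y z + E y z x + E' y z x + E x z y + E' x z y))
  = S (fun x y z => C x y z + C x z y + C y x z + C y z x + C z x y + C z y x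
    + ((x == y) && (y == z))).
  do 3![apply: eq_bigr => ? _]; exact: comparable3_count.
rewrite !SD SE SE' E1 E1' E2 E2' C132 C213 C231 C312 C321 Seq -/SC.
set N := S _ => eqN; change (N + 6 * M = 6 * SC + #|A|); lia.
Qed.

(** * From counts to the closed formulas *)

Section Arithmetic.
Import GRing.Theory Num.Theory.
Local Open Scope ring_scope.

(** Iterated, this turns a binomial coefficient with numeral lower index into a polynomial for
    [field]. It holds for [n < k] as well, both sides being 0. *)
Lemma natr_binS (R : numFieldType) n k :
  'C(n, k.+1)%:R = 'C(n, k)%:R * (n%:R - k%:R) / k.+1%:R :> R.
Proof.
apply: (canRL (mulfK _)); first by rewrite pnatr_eq0.
rewrite -natrM mulnC; case: (leqP k n) => [le_kn|lt_nk].
  by rewrite mul_bin_left -natrB // -natrM mulnC.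
by rewrite !bin_small ?muln0 ?mul0r // ltnW.
Qed.

Lemma pr_multichain3 (R : realFieldType) m : pr_multichain R m.+2 3 =
  ('C(m + 9, 9) + 2 * 'C(m + 8, 9) + 'C(m + 7, 9))%:R / (bg_card m.+2)%:R ^+ 3.
Proof.
rewrite /pr_multichain iid_uniform_pr3 -count_multichain3; congr (_%:R / _).
by do 3![apply: eq_bigr => ? _]; rewrite multichain3.
Qed.

Lemma pr_comparable3 (R : realFieldType) m : pr_comparable R m.+2 3 =
  (6%:R * ('C(m + 9, 9) + 2 * 'C(m + 8, 9) + 'C(m + 7, 9))%:R
   - 6%:R * ('C(m + 6, 6) + 'C(m + 5, 6))%:R + (bg_card m.+2)%:R)
  / (bg_card m.+2)%:R ^+ 3.
Proof.
rewrite /pr_comparable iid_uniform_pr3; congr (_ / _).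
rewrite addrAC; apply/(canRL (addrK _)).
rewrite -!natrM -!natrD -count_multichain2 -count_multichain3.
by rewrite count_comparable3.
Qed.
End Arithmetic.

Local Open Scope ring_scope.

(* The last constant of the first numerator is 70, not the printed 420: with
   420 the right-hand side equals 6 for n = 2, where the probability is 1. *)
Theorem theorem1p6 (R : realFieldType) (n : nat) (hn : (2 <= n)%N) :
  pr_comparable R n 3 =
    ((n ^ 2 + 4 * n + 6)%:R * (bg_card (n + 3))%:R * (bg_card (n + 6))%:R
     - 42 * (n + 6)%:R * (n + 7)%:R * (bg_card (n + 2))%:R
     + 70 * (n + 6)%:R * (n + 7)%:R)
    / (70 * (n + 6)%:R * (n + 7)%:R * (bg_card n)%:R ^+ 2)
  /\
  pr_multichain R n 3 =
    ((n ^ 2 + 4 * n + 6)%:R * (bg_card (n + 3))%:R * (bg_card (n + 6))%:R)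
    / (420 * (n + 6)%:R * (n + 7)%:R * (bg_card n)%:R ^+ 2).
Proof.
have [m ->] : exists m, n = m.+2 by exists n.-2; lia.
have bg k : (bg_card (m.+2 + k))%:R
    = (m%:R + k%:R + 1) * (m%:R + k%:R + 2) * (m%:R + k%:R + 3) / 6 :> R.
  rewrite !addSn card_bigrassmannian !natr_binS bin0 !GRing.natrD; by field.
have bg0 : (bg_card m.+2)%:R = (m%:R + 1) * (m%:R + 2) * (m%:R + 3) / 6 :> R.
  by rewrite -(addn0 m.+2) bg GRing.addr0.
have nz k : m%:R + k.+1%:R != 0 :> R.
  by rewrite -GRing.natrD Num.Theory.pnatr_eq0 addnS.
have nz8 : m%:R + 2 + 6 != 0 :> R by rewrite -GRing.addrA -GRing.natrD (nz 7).
have nz9 : m%:R + 2 + 7 != 0 :> R by rewrite -GRing.addrA -GRing.natrD (nz 8).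
(* These are the factors of the denominators: three from [bg_card m.+2], then n + 6 and n + 7. *)
have := (nz 0, nz 1, nz 2, nz8, nz9)%N.
rewrite pr_comparable3 pr_multichain3 !bg bg0 -[m.+2]addn2.
rewrite !(GRing.natrD, GRing.natrM, GRing.natrX) !natr_binS !bin0 !GRing.natrD.
move: (m%:R : R) => z [[[[z1 z2] z3] z8] z9].
by split; field; rewrite z1 z2 z3 z8 z9.
Qed.
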